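(* Let $n\ge 2$. For any single color $x\in\{r,b,y,g,o,s\}$, \[F(J(T_n(\{x\})),q)=\prod_{j=1}^n j!_q=\prod_{1\le i\le j\le k\le n-1}\frac{[i+1]_q}{[i]_q}.\]
   Context: Let $T_n$ be the set of triples $(c_1,c_2,c_3)$ of nonnegative integers with $c_1+c_2+c_3\le n-2$. To the colors $r,g,y,b,o,s$ associate $v_r=(1,0,0)$, $v_g=(0,1,0)$, $v_y=(0,0,1)$, $v_b=(-1,1,0)$, $v_o=(-1,0,1)$, $v_s=(0,1,-1)$. For a set $S$ of colors, $T_n(S)$ is the poset on $T_n$ whose order is the reflexive–transitive closure of $p<p+v_x$ for $x\in S$ and $p,p+v_x\in T_n$. $J(P)$ is the set of order ideals (down-closed subsets, including $\emptyset$) of $P$, and $F(J(P),q)=\sum_{I\in J(P)}q^{|I|}$. Here $[m]_q=1+q+\dots+q^{m-1}$ and $j!_q=[1]_q[2]_q\cdots[j]_q$. *)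

(* Defs.v *)
From HB Require Import structures.
From mathcomp Require Import all_boot all_order all_algebra.
From mathcomp Require Import zify.

Set Implicit Arguments.
Unset Strict Implicit.
Unset Printing Implicit Defensive.

Import Order.TTheory GRing.Theory Num.Theory.
Local Open Scope ring_scope.

Variant color := Cr | Cg | Cy | Cb | Co | Cs.

Definition color_code (x : color) : 'I_6 :=
  match x with
  | Cr => inord 0 | Cg => inord 1 | Cy => inord 2
  | Cb => inord 3 | Co => inord 4 | Cs => inord 5
  end.

Definition color_decode (i : 'I_6) : color :=
  nth Cr [:: Cr; Cg; Cy; Cb; Co; Cs] i.

Lemma color_codeK : cancel color_code color_decode.
Proof. by case; rewrite /color_decode /= inordK. Qed.

HB.instance Definition _ := Finite.copy color (can_type color_codeK).

Definition color_vec (x : color) : int * int * int :=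
  match x with
  | Cr => (1, 0, 0)
  | Cg => (0, 1, 0)
  | Cy => (0, 0, 1)
  | Cb => (-1, 1, 0)
  | Co => (-1, 0, 1)
  | Cs => (0, 1, -1)
  end.

(* The bound 'I_n.-1 on each coordinate only serves to make the type finite:   *)
(* it is implied by the bound on the sum when 2 <= n. For n < 2 the type is    *)
(* empty, as n - 2 is then negative.                                           *)
Definition tetra (n : nat) : Type :=
  {p : 'I_n.-1 * 'I_n.-1 * 'I_n.-1 | (p.1.1 + p.1.2 + p.2 <= n - 2)%N}.

HB.instance Definition _ n := Finite.on (tetra n).

Definition coords n (p : tetra n) : int * int * int :=
  ((val p).1.1%:Z, (val p).1.2%:Z, (val p).2%:Z).

Definition tetra_step n (S : {set color}) : rel (tetra n) :=
  [rel p q | [exists x in S, coords q == coords p + color_vec x]].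

Definition tetra_poset (n : nat) (S : {set color}) : Type := tetra n.

HB.instance Definition _ n S := Finite.on (tetra_poset n S).

Definition tetra_le n S : rel (tetra_poset n S) := connect (@tetra_step n S).

(* A linear form that is positive on all six vectors. *)
Definition height n (p : tetra n) : nat :=
  ((val p).1.1 + 3 * (val p).1.2 + 2 * (val p).2)%N.

Lemma tetra_step_height n S (p q : tetra n) :
  tetra_step S p q -> (height p < height q)%N.
Proof.
case/existsP=> x /andP[_ /eqP]; rewrite /coords /height.
move: (val p) (val q) => [[a b] c] [[a' b'] c'] /= [].
by case: x => /=; lia.
Qed.

Lemma tetra_le_height n S (p q : tetra_poset n S) :
  tetra_le p q -> p = q \/ (height p < height q)%N.
Proof.
case/connectP=> s; elim: s p => [|r s IHs] p /=; first by move=> _ ->; left.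
case/andP=> /tetra_step_height ltpr /IHs{}IHs /IHs[<-|ltrq]; right=> //.
exact: ltn_trans ltrq.
Qed.

Lemma tetra_le_anti n S : antisymmetric (@tetra_le n S).
Proof.
move=> p q /andP[/tetra_le_height[//|ltpq] /tetra_le_height[//|ltqp]].
by have := ltn_trans ltpq ltqp; rewrite ltnn.
Qed.

Fact tetra_display : Order.disp_t. Proof. exact: Order.Disp tt tt. Qed.

HB.instance Definition _ n S :=
  Order.Le_isPOrder.Build tetra_display (tetra_poset n S)
    (connect0 (@tetra_step n S)) (@tetra_le_anti n S)
    (@connect_trans _ (@tetra_step n S)).

Definition order_ideals d (P : finPOrderType d) : {set {set P}} :=
  [set I : {set P} | [forall p, forall q, (p <= q)%O && (q \in I) ==> (p \in I)]].

(* F(L, q), with the formal variable 'X as q. *)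
Definition card_gf (P : finType) (L : {set {set P}}) : {poly int} :=
  \sum_(I in L) 'X^#|I|.

Definition qint (m : nat) : {poly int} := \sum_(i < m) 'X^i.

Definition qfact (j : nat) : {poly int} := \prod_(1 <= i < j.+1) qint i.

(* Main.v *)
(* With a single color x, the poset T_n({x}) is a disjoint union of chains, the
   lines in direction x. An order ideal amounts to the choice of an initial
   segment of each chain, so the generating function is the product of [l+1]_q
   over the chain lengths l. For every x there are n - l chains of length l,
   for 1 <= l <= n-1, which gives the product of the j!_q. The last product is
   obtained by telescoping over i for fixed j and k. *)
Require Import Defs.
From HB Require Import structures.
From mathcomp Require Import all_boot all_order all_algebra.
From mathcomp Require Import zify.

Set Implicit Arguments.
Unset Strict Implicit.
Unset Printing Implicit Defensive.

Import Order.TTheory GRing.Theory Num.Theory.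
Local Open Scope ring_scope.

(** * Reachability in a disjoint union of chains *)

Lemma connect_chains (P : finType) (T : eqType) (e : rel P)
    (key : P -> T) (pos : P -> nat) (len : T -> nat) :
    (forall p, pos p < len (key p))%N ->
    (forall k i, (i < len k)%N -> exists p, key p = k /\ pos p = i) ->
    (forall p q, key p = key q -> pos p = pos q -> p = q) ->
    (forall p q, e p q = (key p == key q) && (pos q == (pos p).+1)) ->
  forall p q, connect e p q = (key p == key q) && (pos p <= pos q)%N.
Proof.
move=> pos_lt surj inj eE p q; apply/idP/andP=> [/connectP[s]|[/eqP eqK lepq]].
  elim: s p => [|r s IHs] p /= => [_ -> //|]; rewrite eE.
  case/andP=> /andP[/eqP-> /eqP pos_r] /IHs{}IHs /IHs[-> lerq].
  by split=> //; rewrite ltnW // -pos_r.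
have [d Dd] : {d | pos q = pos p + d}%N by exists (pos q - pos p)%N; rewrite subnKC.
elim: d p eqK lepq Dd => [|d IHd] p eqK lepq Dd.
  by rewrite (inj p q) ?connect0 // Dd addn0.
(* The next position is at most [pos q], hence occupied, so the path to [q] can always climb by
   one. *)
have /surj[r [rK r_pos]] : ((pos p).+1 < len (key p))%N.
  by rewrite eqK; apply: leq_ltn_trans (pos_lt q); lia.
apply: (@connect_trans _ _ r); first by rewrite connect1 // eE rK r_pos !eqxx.
by apply: IHd; rewrite ?rK // r_pos; lia.
Qed.

(** * Order ideals of a disjoint union of chains *)

Section ChainUnion.

Variables (d : Order.disp_t) (P : finPOrderType d) (T : finType).
Variables (key : P -> T) (pos : P -> nat) (len : T -> nat).
Hypothesis pos_lt : forall p, (pos p < len (key p))%N.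
Hypothesis pos_surj :
  forall k i, (i < len k)%N -> exists p, key p = k /\ pos p = i.
Hypothesis leE : forall p q, (p <= q)%O = (key p == key q) && (pos p <= pos q)%N.

(** By antisymmetry of the order, a position in a chain is held by a single element, so raising the
    bound by one adds exactly one element. *)
Lemma card_chain_initial k m : (m <= len k)%N ->
  #|[set p | (key p == k) && (pos p < m)%N]| = m.
Proof.
elim: m => [|m IHm] lemk; first by apply: eq_card0 => p; rewrite inE ltn0 andbF.
have [p [pK p_pos]] := pos_surj lemk.
rewrite (_ : [set _ | _] = p |: [set p | (key p == k) && (pos p < m)%N]).
  by rewrite cardsU1 inE p_pos ltnn andbF IHm // ltnW.
apply/setP=> q; rewrite !inE ltnS leq_eqVlt andb_orr; congr (_ || _).
apply/andP/eqP=> [[/eqP qK /eqP q_pos]|->]; last by rewrite pK p_pos.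
by apply: le_anti; rewrite !leE qK pK q_pos p_pos eqxx leqnn.
Qed.

(** A common bound on the lengths gives all cut heights one finite type; [heights] then restricts
    each cut to its own chain. *)
Let N := (\max_k len k)%N.
Let heights := family (fun k => [pred j : 'I_N.+1 | (j <= len k)%N]).
Let lower (f : {ffun T -> 'I_N.+1}) := [set p | (pos p < f (key p))%N].

Lemma card_lower f : f \in heights -> #|lower f| = (\sum_k f k)%N.
Proof.
move=> /familyP fP; rewrite -sum1_card (partition_big key xpredT) //=.
apply: eq_bigr => k _; rewrite -[RHS](card_chain_initial (fP k)) -sum1_card.
by apply: eq_bigl => p; rewrite !inE andbC; case: eqP => // ->.
Qed.

Lemma lower_inj : {in heights &, injective lower}.
Proof.
suff le f g : f \in heights -> g \in heights -> lower f = lower g ->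
    forall k, (f k <= g k)%N.
  move=> f g fP gP eqfg; apply/ffunP=> k; apply/val_inj/anti_leq.
  by rewrite !le.
move=> /familyP fP /familyP gP eqfg k; rewrite leqNgt; apply/negP=> ltgf.
(* The element of chain [k] at position [g k] lies in [lower f] but not in [lower g]. *)
have [p [pK p_pos]] := pos_surj (leq_trans ltgf (fP k)).
by move/setP: eqfg => /(_ p); rewrite !inE pK p_pos ltgf ltnn.
Qed.

Lemma order_ideals_chains : order_ideals P = [set lower f | f in heights].
Proof.
apply/setP=> I; rewrite inE; apply/forallP/imsetP=> [idI | [f fP ->] p].
  have leN k : (\max_(p in I | key p == k) (pos p).+1 <= len k)%N.
    by apply/bigmax_leqP=> p /andP[_ /eqP <-].
  (* Each chain is cut just above the highest element of [I]; with the successor inside, the empty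
     maximum gives height 0 to a chain that misses [I]. *)
  exists [ffun k => inord (\max_(p in I | key p == k) (pos p).+1)].
    apply/familyP=> k; rewrite ffunE inE inordK // ltnS.
    exact: leq_trans (leN k) (leq_bigmax k).
  apply/setP=> p; rewrite inE ffunE inordK; last first.
    exact: leq_trans (leN _) (leq_bigmax (key p)).
  apply/idP/idP=> [pI|].
    by rewrite (@leq_bigmax_cond _ _ (fun p => (pos p).+1) p) ?pI /=.
  apply: contraLR => pNI; rewrite -leqNgt; apply/bigmax_leqP=> q /andP[qI qK].
  rewrite ltnNge; apply: contra pNI => lepq.
  by have /forallP/(_ q)/implyP-> := idI p; rewrite // leE eq_sym qK lepq.
apply/forallP=> q; apply/implyP; rewrite leE !inE => /andP[/andP[/eqP-> lepq]].
exact: leq_ltn_trans.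
Qed.

(** Expanding the product of sums by distributivity picks one exponent per chain, that is, one
    member of [heights]. *)
Lemma card_gf_chains : card_gf (order_ideals P) = \prod_k qint (len k).+1.
Proof.
rewrite /card_gf order_ideals_chains big_imset; last exact: lower_inj.
have qintE k : qint (len k).+1 = \sum_(j < N.+1 | (j <= len k)%N) 'X^j.
  have leN : (len k < N.+1)%N by rewrite ltnS leq_bigmax.
  by rewrite /qint (big_ord_widen_cond _ xpredT (fun i => 'X^i) leN).
rewrite (eq_bigr _ (fun k _ => qintE k)) bigA_distr_big_dep.
apply: eq_bigr => f fP; rewrite card_lower //.
by rewrite (big_morph _ (exprD 'X) (expr0 'X)).
Qed.

End ChainUnion.

(** * Chain decomposition of the tetrahedral poset for one color *)

Section TetraChains.

Variables (m : nat) (x : color).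
Local Notation n := m.+2.

Lemma tetra_bound (p : tetra n) : ((val p).1.1 + (val p).1.2 + (val p).2 <= m)%N.
Proof. by apply: leq_trans (valP p) _; rewrite subn2. Qed.

Lemma tetra_exists a b c : (a + b + c <= m)%N ->
  exists p : tetra n, [/\ (val p).1.1 = a :> nat, (val p).1.2 = b :> nat
    & (val p).2 = c :> nat].
Proof.
move=> abc; have ltS i : (i <= a + b + c -> i < m.+1)%N by lia.
have vP : (@inord m a + @inord m b + @inord m c <= n - 2)%N.
  by rewrite !inordK ?ltS ?subn2 //; lia.
by exists (exist _ (inord a, inord b, inord c) vP); split; rewrite /= inordK ?ltS; lia.
Qed.

Lemma tetra_inj (p q : tetra n) : (val p).1.1 = (val q).1.1 :> nat ->
  (val p).1.2 = (val q).1.2 :> nat -> (val p).2 = (val q).2 :> nat -> p = q.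
Proof.
move=> /val_inj + /val_inj + /val_inj; case: p q => [[[a b] c] p] [[[a' b'] c'] q] /=.
by move=> eqa eqb eqc; apply/val_inj; rewrite /= eqa eqb eqc.
Qed.

(* The chains are the lines in direction x; the first entry of the key of a
   chain is its length minus one, so that for every color the keys are the pairs
   (u, w) with u + w <= m. *)
Definition chain_data (a b c : nat) : nat * nat * nat :=
  match x with
  | Cr => (m - (b + c), c, a)
  | Cg => (m - (a + c), c, b)
  | Cy => (m - (a + b), b, c)
  | Cb => (a + b, c, b)
  | Co => (a + c, b, c)
  | Cs => (b + c, a, b)
  end%N.

Definition tetra_data (p : tetra n) :=
  chain_data (val p).1.1 (val p).1.2 (val p).2.

Definition tetra_key (p : tetra n) : 'I_m.+1 * 'I_m.+1 :=
  (inord (tetra_data p).1.1, inord (tetra_data p).1.2).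

Definition tetra_pos (p : tetra n) := (tetra_data p).2.

(** Pairs outside the triangle of actual keys get an empty chain, whose factor is [qint 1], equal to
    1. *)
Definition chain_len (k : 'I_m.+1 * 'I_m.+1) : nat :=
  if (k.1 + k.2 <= m)%N then k.1.+1 else 0%N.

Lemma tetra_data_bound (p : tetra n) : let: (u, w, i) := tetra_data p in
  (u + w <= m)%N /\ (i <= u)%N.
Proof.
by have := tetra_bound p; rewrite /tetra_data /chain_data; case: x => /=; lia.
Qed.

Lemma tetra_keyE (p : tetra n) :
  ((tetra_key p).1 = (tetra_data p).1.1 :> nat) *
  ((tetra_key p).2 = (tetra_data p).1.2 :> nat).
Proof.
by have := tetra_data_bound p; rewrite /tetra_key; case: tetra_data => [[u w] i] /=;
   split; rewrite inordK //; lia.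
Qed.

Lemma tetra_key_eq (p q : tetra n) :
  (tetra_key p == tetra_key q) = ((tetra_data p).1 == (tetra_data q).1).
Proof. by rewrite !xpair_eqE -!(inj_eq val_inj) /= !tetra_keyE. Qed.

Lemma tetra_pos_lt p : (tetra_pos p < chain_len (tetra_key p))%N.
Proof.
rewrite /chain_len !tetra_keyE /tetra_pos; have := tetra_data_bound p.
by case: tetra_data => [[u w] i] /= [-> lt].
Qed.

Lemma tetra_data_surj (u w i : nat) : (u + w <= m)%N -> (i <= u)%N ->
  exists p, tetra_data p = (u, w, i).
Proof.
move=> uw iu.
have [[[a b] c] [abc dataE]] : exists t : nat * nat * nat,
    (t.1.1 + t.1.2 + t.2 <= m)%N /\ chain_data t.1.1 t.1.2 t.2 = (u, w, i).
  (* The inverse of [chain_data], color by color. *)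
  exists (match x with
    | Cr => (i, m - u - w, w) | Cg => (m - u - w, i, w)
    | Cy => (m - u - w, w, i) | Cb => (u - i, i, w)
    | Co => (u - i, w, i) | Cs => (w, i, u - i)
    end)%N.
  by rewrite /chain_data; case: x => /=; split; do ?congr pair; lia.
by have [p [pa pb pc]] := tetra_exists abc; exists p; rewrite /tetra_data pa pb pc.
Qed.

Lemma tetra_pos_surj k i : (i < chain_len k)%N ->
  exists p, tetra_key p = k /\ tetra_pos p = i.
Proof.
rewrite /chain_len; case: ifP => // uw iu.
have [p pD] := tetra_data_surj uw iu.
by exists p; rewrite /tetra_key /tetra_pos pD !inord_val -surjective_pairing.
Qed.

(** By [tetra_bound] the subtractions in [chain_data] are never truncated, so the coordinates can be
    solved for. *)
Lemma tetra_data_inj : injective tetra_data.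
Proof.
move=> p q; have := tetra_bound p; have := tetra_bound q.
rewrite /tetra_data /chain_data => bp bq eqd.
by apply: tetra_inj; case: x eqd => /= -[]; rewrite /= in bp bq *; lia.
Qed.

(** The key entries are invariant under translation by [color_vec x], and the position is a
    coordinate that this translation raises by 1. *)
Lemma tetra_stepE (p q : tetra n) : tetra_step [set x] p q =
  (tetra_key p == tetra_key q) && (tetra_pos q == (tetra_pos p).+1).
Proof.
rewrite /tetra_step /= tetra_key_eq.
transitivity (coords q == coords p + color_vec x).
  apply/exists_inP/idP=> [[y] | eqpq]; first by rewrite inE => /eqP->.
  by exists x; rewrite ?inE.
have := tetra_bound p; have := tetra_bound q.
rewrite /tetra_pos /tetra_data /coords /chain_data.
case: (val p) (val q) => [[a b] c] [[a' b'] c'].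
by case: x; rewrite !xpair_eqE /=; lia.
Qed.

Lemma tetra_leE (p q : tetra_poset n [set x]) :
  (p <= q)%O = (tetra_key p == tetra_key q) && (tetra_pos p <= tetra_pos q)%N.
Proof.
apply: (connect_chains tetra_pos_lt tetra_pos_surj _ tetra_stepE) => {}p {}q.
move=> /eqP; rewrite tetra_key_eq /tetra_pos => /eqP eqk eqp.
by apply: tetra_data_inj; rewrite [LHS]surjective_pairing eqk eqp -surjective_pairing.
Qed.

Lemma card_gf_tetra : card_gf (order_ideals (tetra_poset n [set x])) =
  \prod_(k : 'I_m.+1 * 'I_m.+1) qint (chain_len k).+1.
Proof.
exact: (@card_gf_chains _ (tetra_poset n [set x]) _ _ _ _
  tetra_pos_lt tetra_pos_surj tetra_leE).
Qed.

End TetraChains.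

(** * Identities between products of q-integers *)

Lemma qint1 : qint 1 = 1.
Proof. by rewrite /qint big_ord1. Qed.

(** The constant coefficient is 1. *)
Lemma qint_neq0 m : qint m.+1 != 0.
Proof.
apply/eqP=> /(congr1 (fun p : {poly int} => p`_0)); rewrite coef_sum coef0.
by rewrite big_ord_recl [X in _ + X]big1 => [|i _]; rewrite coefXn // addr0.
Qed.

(** Both sides run over the triangle [m <= i <= j < n], by rows and by columns. *)
Lemma triangular_prod (R : comNzRingType) m n (F : nat -> nat -> R) :
  \prod_(m <= i < n) \prod_(i <= j < n) F i j =
  \prod_(m <= j < n) \prod_(m <= i < j.+1) F i j.
Proof.
transitivity (\prod_(m <= i < n) \prod_(m <= j < n | (i <= j)%N) F i j).
  by apply: eq_big_nat => i /andP[lemi _]; rewrite (big_nat_widenl i m).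
rewrite (exchange_big_dep_nat xpredT) //=; apply: eq_big_nat => j /andP[_ ltjn].
by rewrite [RHS](big_nat_widen _ _ n).
Qed.

Lemma prod_chain_len m :
  \prod_(k : 'I_m.+1 * 'I_m.+1) qint (chain_len k).+1 =
  \prod_(1 <= j < m.+3) qfact j.
Proof.
(* The factorial of 1 and the factor [qint 1] of every other factorial are dropped, which accounts
   for the index shift by 2. *)
rewrite big_ltn // /qfact big_nat1 qint1 mul1r big_add1 /=.
under [RHS]eq_bigr => j _ do rewrite big_ltn // qint1 mul1r big_add1 /=.
rewrite [RHS]big_add1 /=.
transitivity (\prod_(0 <= i < m.+1) \prod_(i <= j < m.+1) qint i.+2).
  rewrite -(pair_bigA _ (fun u w => qint (chain_len (u, w)).+1)) big_mkord /=.
  (* With [j = i + w], the second key entry [w] ranges over the [m.+1 - i] chains of length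
     [i.+1]. *)
  apply: eq_bigr => i _; rewrite -[X in \prod_(X <= _ < _) _]add0n big_addn.
  rewrite [RHS](big_nat_widen _ _ m.+1) ?leq_subr // big_mkord [RHS]big_mkcond /=.
  apply: eq_bigr => w _; rewrite /chain_len /= ltn_subRL ltnS.
  by case: ifP; rewrite // qint1.
by rewrite triangular_prod; apply: eq_bigr => j _; rewrite big_add1.
Qed.

Lemma prod_qfactE n : tofrac (\prod_(1 <= j < n.+1) qfact j)
  = \prod_(1 <= i < n) \prod_(i <= j < n) \prod_(j <= k < n)
        (tofrac (qint i.+1) / tofrac (qint i)) :> {fraction {poly int}}.
Proof.
(* Exchanges of the order of multiplication bring [k] outermost and [i] innermost; the product over
   [i] then telescopes to [qint j.+1], and the one over [j] gives [qfact k.+1]. *)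
under [RHS]eq_bigr => i _ do rewrite triangular_prod.
rewrite triangular_prod (big_morph _ (@tofracM _) (tofrac1 _)).
case: n => [|n]; first by rewrite !big_geq.
rewrite big_ltn // {1}/qfact big_nat1 qint1 tofrac1 mul1r big_add1 /=.
apply: eq_big_nat => k _.
rewrite triangular_prod /qfact (big_morph _ (@tofracM _) (tofrac1 _)).
rewrite big_ltn // qint1 tofrac1 mul1r big_add1 /=.
apply: eq_big_nat => j /andP[j_gt0 _].
rewrite telescope_prodf ?qint1 ?tofrac1 ?divr1 // => -[|i] // _.
by rewrite tofrac_eq0 qint_neq0.
Qed.

Theorem theorem7 (n : nat) (hn : (2 <= n)%N) (x : color) :
  card_gf (order_ideals (tetra_poset n [set x]))
    = \prod_(1 <= j < n.+1) qfact j
  /\ tofrac (\prod_(1 <= j < n.+1) qfact j)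
    = \prod_(1 <= i < n) \prod_(i <= j < n) \prod_(j <= k < n)
        (tofrac (qint i.+1) / tofrac (qint i)) :> {fraction {poly int}}.
Proof.
split; last exact: prod_qfactE.
by case: n hn => [|[|m]] // _; rewrite card_gf_tetra prod_chain_len.
Qed.
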